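(* Let $X:\Sigma^n\to\mathbb{R}^{n+m}$ ($n,m\ge1$) be a complete and non-compact $C$-soliton for the inverse mean curvature flow (IMCF) with respect to $\vec 0\in\mathbb{R}^{n+m}$. Suppose that $\Sigma$ is parabolic. Then: (1) either $X(\Sigma)$ is unbounded in $\mathbb{R}^{n+m}$, (2) or $X(\Sigma)$ is bounded and, for every $R>0$ such that $X(\Sigma)$ is contained in the ball of radius $R$ centered at $\vec 0$, one has $C=\frac1n$, $X(\Sigma)\subseteq S^{n+m-1}(r_0)$ for some $r_0\le R$, and $X:\Sigma^n\to S^{n+m-1}(r_0)$ is a minimal immersion.
   Context: A complete isometric immersion $X:\Sigma^n\to\mathbb{R}^{n+m}$ of an $n$-dimensional Riemannian manifold is a $C$-soliton for the IMCF with respect to $\vec 0$ ($C\in\mathbb{R}$) if $\vec H$ is nowhere zero and $\dfrac{\vec H}{\|\vec H\|^2}=-C X^\perp$ on $\Sigma$, where $\vec H$ is the mean curvature vector of $X$ (the trace of the second fundamental form, so $\vec H=\Delta^\Sigma X$) and $X^\perp$ is the component of the position vector $X$ normal to $\Sigma$. $S^{n+m-1}(r_0)$ is the sphere of radius $r_0$ centered at $\vec 0$ in $\mathbb{R}^{n+m}$. A complete Riemannian manifold $M$ is parabolic if every continuous subharmonic function $u:M\to\mathbb{R}$ ($\Delta u\ge 0$ when $u\in C^2$) with $\sup_M u<\infty$ is constant. *)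

(* Defs.v *)
From HB Require Import structures.
From mathcomp Require Import all_boot all_order all_algebra.
From mathcomp Require Import all_classical all_reals all_analysis.

Set Implicit Arguments.
Unset Strict Implicit.
Unset Printing Implicit Defensive.

Import Order.TTheory GRing.Theory Num.Theory.
Import numFieldNormedType.Exports.
Local Open Scope classical_set_scope.
Local Open Scope ring_scope.

(* Euclidean structure of R^N = 'rV_N. The library norm `|x| on 'rV_N is the
   sup norm: it gives the right topology and the right derivatives, but not
   the right lengths. *)
Definition edot (R : realType) (N : nat) (u v : 'rV[R]_N) : R :=
  (u *m v^T) 0 0.

Definition enorm (R : realType) (N : nat) (u : 'rV[R]_N) : R :=
  Num.sqrt (edot u u).

Definition eball (R : realType) (N : nat) (r : R) : set 'rV[R]_N :=
  [set y | enorm y <= r].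

Definition esphere (R : realType) (N : nat) (r : R) : set 'rV[R]_N :=
  [set y | enorm y = r].

(* The component of y orthogonal to the row space of A. *)
Definition orth_part (R : realType) (k N : nat) (A : 'M[R]_(k, N))
  (y : 'rV[R]_N) : 'rV[R]_N :=
  y *m proj_mx (kermx A^T) <<A>>%MS.

(* f is of class C^k on the open set U. *)
Fixpoint Ck (R : realType) (V W : normedModType R) (k : nat) (U : set V)
  (f : V -> W) : Prop :=
  if k is k'.+1 then
    (forall x, U x -> differentiable f x) /\
    (forall v, Ck k' U (fun x => 'D_v f x))
  else forall x, U x -> {for x, continuous f}.

Definition partial (R : realType) (n : nat) (W : normedModType R) (i : 'I_n)
  (f : 'rV[R]_n -> W) (x : 'rV[R]_n) : W :=
  'D_(delta_mx 0 i) f x.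

(* The transposed Jacobian matrix: its i-th row is the i-th partial
   derivative of f. *)
Definition frame (R : realType) (n N : nat) (f : 'rV[R]_n -> 'rV[R]_N)
  (x : 'rV[R]_n) : 'M[R]_(n, N) :=
  \matrix_(i < n) partial i f x.

(* [coord] and [param] are total functions, meaningful only on [dom] and on
   its image [cimage] respectively. *)
Record chart (R : realType) (n : nat) (T : topologicalType) := Chart {
  dom : set T;
  coord : T -> 'rV[R]_n;
  param : 'rV[R]_n -> T;
  dom_open : open dom;
  cimage_open : open (coord @` dom);
  paramK : forall p, dom p -> param (coord p) = p;
  coord_continuous : forall p, dom p -> {for p, continuous coord};
  param_continuous : forall p, dom p -> {for coord p, continuous param}
}.

Definition cimage (R : realType) (n : nat) (T : topologicalType)
  (c : chart R n T) : set 'rV[R]_n := coord c @` dom c.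

Record smoothManifold (R : realType) (n : nat) := SmoothManifold {
  carrier :> topologicalType;
  atlas : set (chart R n carrier);
  manifold_hausdorff : hausdorff_space carrier;
  manifold_second_countable : @second_countable carrier;
  manifold_connected : connected [set: carrier];
  atlas_cover : forall p, exists2 c, atlas c & dom c p;
  atlas_smooth : forall c c', atlas c -> atlas c' ->
    forall k, Ck k (coord c @` (dom c `&` dom c')) (coord c' \o param c)
}.

(* [metric c x] is the matrix (g_ij) at x in the chart c. *)
Record riemannianManifold (R : realType) (n : nat) := RiemannianManifold {
  underlying :> smoothManifold R n;
  metric : chart R n underlying -> 'rV[R]_n -> 'M[R]_n;
  metric_smooth : forall c, atlas c -> forall k, Ck k (cimage c) (metric c);
  metric_sym : forall c, atlas c -> forall x, cimage c x ->
    (metric c x)^T = metric c x;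
  metric_pos : forall c, atlas c -> forall x, cimage c x ->
    forall v : 'rV[R]_n, v != 0 -> 0 < (v *m metric c x *m v^T) 0 0;
  metric_change : forall c c', atlas c -> atlas c' ->
    forall p, dom c p -> dom c' p ->
    let D := frame (coord c' \o param c) (coord c p) in
    metric c (coord c p) = D *m metric c' (coord c' p) *m D^T
}.

Section Intrinsic.
Variables (R : realType) (n : nat) (M : riemannianManifold R n).

Definition C1_curve (gam : R -> M) : Prop :=
  continuous gam /\
  forall c : chart R n M, atlas c ->
    Ck 1 (gam @^-1` dom c : set R) (coord c \o gam).

(* s t is the Riemannian norm of the velocity of gam at time t. *)
Definition is_speed (gam : R -> M) (s : R -> R) : Prop :=
  forall (t : R) (c : chart R n M), atlas c -> dom c (gam t) ->
    let v := 'D_1 (coord c \o gam) t in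
    s t = Num.sqrt ((v *m metric c (coord c (gam t)) *m v^T) 0 0).

(* A piecewise C^1 curve can be reparametrized to a C^1 curve of the same
   length, by letting its velocity vanish at the corners and at the two ends,
   so C^1 curves defined on the whole line give the usual distance. *)
Definition rdist (p q : M) : \bar R :=
  ereal_inf [set (\int[lebesgue_measure]_(t in `[0%R, 1%R]) (gs.2 t)%:E)%E |
    gs in [set gs : (R -> M) * (R -> R) |
      [/\ C1_curve gs.1, is_speed gs.1 gs.2, gs.1 0 = p & gs.1 1 = q]]].

Definition complete_manifold : Prop :=
  forall u : nat -> M,
    (forall e : R, 0 < e -> exists k, forall i j, (k <= i)%N -> (k <= j)%N ->
       (rdist (u i) (u j) < e%:E)%E) ->
    exists p : M, forall e : R, 0 < e -> exists k, forall i, (k <= i)%N ->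
       (rdist (u i) p < e%:E)%E.

Definition christoffel (c : chart R n M) (k i j : 'I_n) (x : 'rV[R]_n) : R :=
  2^-1 * \sum_(l < n) invmx (metric c x) k l *
    (partial i (fun y => metric c y j l) x
     + partial j (fun y => metric c y i l) x
     - partial l (fun y => metric c y i j) x).

(* The Laplace-Beltrami operator in the chart c: the trace of the covariant
   Hessian. *)
Definition laplacian (c : chart R n M) (u : M -> R) (x : 'rV[R]_n) : R :=
  \sum_(i < n) \sum_(j < n) invmx (metric c x) i j *
    (partial i (partial j (u \o param c)) x
     - \sum_(k < n) christoffel c k i j x * partial k (u \o param c) x).

Definition harmonic (D : set M) (h : M -> R) : Prop :=
  forall c : chart R n M, atlas c ->
    Ck 2 (coord c @` (dom c `&` D)) (h \o param c) /\
    forall p, dom c p -> D p -> laplacian c h (coord c p) = 0.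

(* Continuous subharmonic functions, by comparison with harmonic functions.
   Subharmonicity is local, so only open sets which are relatively compact in
   the domain of a chart are used, as Euclidean balls are in R^n. *)
Definition subharmonic (u : M -> R) : Prop :=
  continuous u /\
  forall (c : chart R n M) (D : set M), atlas c ->
    open D -> compact (closure D) -> closure D `<=` dom c ->
    forall h : M -> R, {within closure D, continuous h} -> harmonic D h ->
      (forall p, (closure D `\` D) p -> u p <= h p) ->
      forall p, D p -> u p <= h p.

Definition parabolic : Prop :=
  forall u : M -> R, subharmonic u -> (exists K, forall p, u p <= K) ->
    exists k, forall p, u p = k.

End Intrinsic.

Section Extrinsic.
Variables (R : realType) (n N : nat) (M : riemannianManifold R n).
Variable X : M -> 'rV[R]_N.

(* Since the metric is positive definite, the differential of X is
   automatically injective. *)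
Definition isometric_immersion : Prop :=
  forall c : chart R n M, atlas c ->
    (forall k, Ck k (cimage c) (X \o param c)) /\
    (forall x, cimage c x -> forall i j : 'I_n,
       metric c x i j =
       edot (partial i (X \o param c) x) (partial j (X \o param c) x)).

Definition normal_part (c : chart R n M) (x : 'rV[R]_n) (y : 'rV[R]_N) :
  'rV[R]_N :=
  orth_part (frame (X \o param c) x) y.

(* The second fundamental form of X in R^N on the i-th and j-th coordinate
   vector fields: the normal component of the Euclidean derivative. *)
Definition sff (c : chart R n M) (i j : 'I_n) (x : 'rV[R]_n) : 'rV[R]_N :=
  normal_part c x (partial i (partial j (X \o param c)) x).

Definition mean_curvature (c : chart R n M) (x : 'rV[R]_n) : 'rV[R]_N :=
  \sum_(i < n) \sum_(j < n) invmx (metric c x) i j *: sff c i j x.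

Definition IMCF_soliton (C : R) : Prop :=
  forall c : chart R n M, atlas c -> forall p, dom c p ->
    let H := mean_curvature c (coord c p) in
    H != 0 /\
    (enorm H ^+ 2)^-1 *: H = - C *: normal_part c (coord c p) (X p).

(* The second fundamental form of X as an immersion in the sphere centered at
   0 which contains its image: the Levi-Civita derivative of the sphere is the
   component of the Euclidean derivative orthogonal to the position vector. *)
Definition sphere_sff (c : chart R n M) (i j : 'I_n) (x : 'rV[R]_n) :
  'rV[R]_N :=
  normal_part c x
    (orth_part (X (param c x)) (partial i (partial j (X \o param c)) x)).

Definition sphere_mean_curvature (c : chart R n M) (x : 'rV[R]_n) :
  'rV[R]_N :=
  \sum_(i < n) \sum_(j < n) invmx (metric c x) i j *: sphere_sff c i j x.

Definition minimal_immersion_in_sphere (r : R) : Prop :=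
  [/\ isometric_immersion, range X `<=` esphere r &
      forall c : chart R n M, atlas c -> forall x, cimage c x ->
        sphere_mean_curvature c x = 0].

End Extrinsic.

(* Main.v *)
Require Import Defs.
From mathcomp Require Import all_boot all_order all_algebra.
From mathcomp Require Import ring lra.
From mathcomp Require Import all_classical all_reals all_analysis.
Import Order.TTheory GRing.Theory Num.Theory.
Import numFieldNormedType.Exports.
Set Implicit Arguments.
Unset Strict Implicit.
Unset Printing Implicit Defensive.
Local Open Scope classical_set_scope.
Local Open Scope ring_scope.

(* Since an isometric immersion satisfies Delta X = H, one has
   Delta |X|^2 = 2 (n + <H, X>), and pairing the soliton equation with H gives
   <H, X> = - 1 / C: the Laplacian of |X|^2 is the constant 2 (n - 1 / C). If X
   is bounded, |X|^2 or - |X|^2 is subharmonic and bounded above, hence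
   constant by parabolicity; therefore C = 1 / n and X takes its values in a
   sphere. There X is normal to Sigma, so that H is a multiple of X and the
   mean curvature in the sphere vanishes.

   That a nonnegative Laplacian implies the comparison principle with harmonic
   functions is the weak maximum principle, with the barrier exp (K y_i) in a
   chart. *)

(** * Second-order calculus *)

(** Two obstacles shape the maximum principle. At an interior maximum only the pure second
    directional derivatives have a sign, so the inverse metric has to be written as [B *m B^T]; the
    immersion itself provides [B], because the metric is the Gram matrix of the frame of [X].
    Moreover a nonnegative Laplacian does not contradict an interior maximum: a small multiple of
    the barrier makes the inequality strict, and its coefficient is then made arbitrarily small.

    The Laplacian is defined from the metric alone, through Christoffel symbols. To get Delta X = H,
    the tangential part of the second derivatives of [X] must be recovered from derivatives of the
    metric. This rests on the symmetry of second derivatives, which is the purpose of the mixed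
    differences. *)

Lemma exists_between0 (R : realType) (d e : R) : 0 < d -> 0 < e ->
  exists b, [/\ 0 < b, b < d & b < e].
Proof.
by move=> d0 e0; have [de|ed] := leP d e; [exists (d / 2)|exists (e / 2)];
  split; lra.
Qed.

Lemma is_derive_within_continuous (R : realType) (g dg : R -> R) (a b : R) :
  (forall t, t \in `[a, b]%R -> is_derive t 1 g (dg t)) ->
  {within `[a, b], continuous g}.
Proof.
move=> h; apply: derivable_within_continuous => t tab.
exact: (@ex_derive _ _ _ _ _ _ _ (h t tab)).
Qed.

(** If [dg], which vanishes at 0, had a positive derivative there, it would be positive just to the
    right of 0, and the mean value theorem would give [g b > g 0] for a small [b > 0]. *)
Lemma second_derivative_at_max1 (R : realType) (g dg : R -> R) (d : R) :
  0 < d -> (forall t : R, `|t| <= d -> is_derive t (1 : R) g (dg t)) ->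
  (forall t : R, `|t| <= d -> g t <= g 0) -> derivable dg 0 1 ->
  dg 0 = 0 /\ 'D_1 dg 0 <= 0.
Proof.
move=> d0 gd gmax dgd.
have itvd (t : R) : t \in `](- d), d[%R -> `|t| <= d.
  by rewrite in_itv /= ler_norml => /andP[/ltW -> /ltW ->].
have D0 : dg 0 = 0.
  have d00 : `|0 : R| <= d by rewrite normr0 ltW.
  have <- : 'D_1 g 0 = dg 0 by case: (gd 0 d00).
  have : is_derive (0 : R) 1 g 0.
    apply: (@derive1_at_max R g (- d) d 0).
    - by rewrite ge0_cp// ltW.
    - by move=> t /itvd/gd[].
    - by rewrite in_itv /= oppr_lt0 d0.
    - by move=> t /itvd td; exact: gmax.
  by case.
split=> //; rewrite leNgt; apply/negP => l0.
have lim0 : (fun h : R => h^-1 * dg h) @ 0^' --> 'D_1 dg 0.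
  have -> : (fun h : R => h^-1 * dg h) =
     (fun h : R => h^-1 *: ((dg \o shift 0) (h *: 1) - dg 0)).
    by apply/funext => h /=; rewrite addr0 [h *: 1]mulr1 D0 subr0.
  exact: dgd.
have /nbhs_ballP[e /= e0 he] : \forall h \near 0^', 0 < h^-1 * dg h.
  by move/cvgr_gt: lim0; apply.
have [b [b0 bd be]] := exists_between0 d0 e0.
have gbd (t : R) : t \in `[0, b]%R -> is_derive t (1 : R) g (dg t).
  rewrite in_itv /= => /andP[t0 tb]; apply: gd.
  by rewrite ger0_norm// (le_trans tb)// ltW.
have cg := is_derive_within_continuous gbd.
have gbo (t : R) : t \in `]0, b[%R -> is_derive t (1 : R) g (dg t).
  by move=> /subset_itv_oo_cc/gbd.
have [c] := MVT b0 gbo cg.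
rewrite in_itv /= => /andP[c0 cb] /eqP; apply/negP.
rewrite lt_eqF// subr0 (@le_lt_trans _ _ 0)//.
  rewrite subr_le0; apply: gmax.
  by rewrite gtr0_norm// ltW.
rewrite mulr_gt0//.
have := he c; rewrite -ball_normE /ball_ /= sub0r normrN gtr0_norm//.
rewrite (lt_trans cb be) => /(_ isT); rewrite gt_eqF// => /(_ isT).
by rewrite pmulr_rgt0// invr_gt0.
Qed.

(** Here [a], [b], [c], [d] stand for the values of a function at the corners of a parallelogram:
    [a - b - (c - d)] and [a - c - (b - d)] are the same number, approximated in two ways. *)
Lemma mixed_difference_arith (R : realFieldType) (s a b c d A B e : R) :
  0 < s -> `|a - b - (c - d) - A * (s * s)| <= e / 2 * (s * s) ->
  `|a - c - (b - d) - B * (s * s)| <= e / 2 * (s * s) -> `|A - B| <= e.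
Proof.
move=> s0; rewrite !ler_norml => /andP[h1 h2] /andP[h3 h4].
have ss0 : 0 < s * s by rewrite mulr_gt0.
by apply/andP; split; rewrite -(ler_pM2r ss0); lra.
Qed.

Section Lines.
Variables (R : realType) (V : normedModType R).
Implicit Types (G : V -> R) (x v w : V).

Lemma is_derive_line (W : normedModType R) (G : V -> W) x v (s : R) :
  derivable G (x + s *: v) v ->
  is_derive s 1 (fun t : R => G (x + t *: v)) ('D_v G (x + s *: v)).
Proof.
have E : (fun h : R => h^-1 *:
      (((fun t : R => G (x + t *: v)) \o shift s) (h *: 1) - G (x + s *: v))) =
    (fun h : R => h^-1 *:
      ((G \o shift (x + s *: v)) (h *: v) - G (x + s *: v))).
  apply/funext => h /=.
  by rewrite [h *: 1]mulr1 scalerDl addrCA.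
move=> dG; apply: DeriveDef; first by rewrite /derivable E.
by rewrite /derive E.
Qed.

Lemma near_line2 x v w (P : V -> Prop) : (\forall y \near x, P y) ->
  exists2 d : R, 0 < d & forall s t, `|s| <= d -> `|t| <= d ->
    P (x + s *: v + t *: w).
Proof.
move=> /nbhs_ballP[e /= e0 Pe].
have k0 : 0 < `|v| + `|w| + 1 by rewrite ltr_wpDl ?addr_ge0.
(* The [+ 1] keeps the denominator positive when [v] and [w] vanish, and makes the final bound
   strict. *)
exists (e / (`|v| + `|w| + 1)); first by rewrite divr_gt0.
move=> s t sd td; apply: Pe; rewrite -ball_normE /ball_ /=.
rewrite -addrA opprD addNKr normrN.
apply: le_lt_trans (ler_normD _ _) _; rewrite !normrZ.
have d0 : 0 < e / (`|v| + `|w| + 1) by rewrite divr_gt0.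
apply: (@le_lt_trans _ _ (e / (`|v| + `|w| + 1) * (`|v| + `|w|))).
  by rewrite mulrDr lerD// ler_wpM2r.
rewrite -mulrA gtr_pMr// mulrC ltr_pdivrMr// mul1r ltrDl //.
Qed.

Lemma near_line x v (P : V -> Prop) : (\forall y \near x, P y) ->
  exists2 d : R, 0 < d & forall s, `|s| <= d -> P (x + s *: v).
Proof.
move=> /(near_line2 v 0)[d d0 h]; exists d => // s sd.
by have := h s 0 sd; rewrite normr0 scale0r addr0; apply; rewrite ltW.
Qed.

Lemma second_derivative_at_max G x v :
  (\forall y \near x, G y <= G x) -> (\forall y \near x, derivable G y v) ->
  derivable ('D_v G) x v ->
  'D_v G x = 0 /\ 'D_v ('D_v G) x <= 0.
Proof.
move=> Gmax Gd G2d.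
have [d d0 hd] := near_line v (filterI Gmax Gd).
have G2d0 : derivable ('D_v G) (x + 0 *: v) v by rewrite scale0r addr0.
pose g (t : R) := G (x + t *: v).
pose dg (t : R) := 'D_v G (x + t *: v).
have [dgd dgE] : is_derive (0 : R) (1 : R) dg ('D_v ('D_v G) (x + 0 *: v)).
  exact: is_derive_line.
have gd (t : R) : `|t| <= d -> is_derive t (1 : R) g (dg t).
  by move=> td; apply: is_derive_line; exact: (hd t td).2.
have gm (t : R) : `|t| <= d -> g t <= g 0.
  by move=> td; rewrite /g scale0r addr0; exact: (hd t td).1.
have [A B] := second_derivative_at_max1 d0 gd gm dgd.
rewrite dgE scale0r addr0 in B.
split; last exact: B.
by rewrite -A /dg scale0r addr0.
Qed.

(* The mixed second difference is symmetric in [v] and [w], so approximating it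
   in both orders identifies the two mixed derivatives. *)
Lemma mixed_difference_approx G x v w (e : R) : 0 < e ->
  (\forall y \near x, derivable G y v) ->
  (\forall y \near x, derivable ('D_v G) y w) ->
  {for x, continuous ('D_w ('D_v G))} ->
  \forall s \near 0^'+,
    `|G (x + s *: v + s *: w) - G (x + s *: v) - (G (x + s *: w) - G x)
      - 'D_w ('D_v G) x * (s * s)| <= e * (s * s).
Proof.
move=> e0 d1 d2 /cvgrPdist_le/(_ e e0) c.
have [d d0 hd] := near_line2 v w (filterI (filterI d1 d2) c).
near=> s.
have s0 : 0 < s by [].
have sd : s <= d by near: s; exact: nbhs_right_le.
(* The mean value theorem is applied along [v] to [g], then along [w] to ['D_v G]: the mixed
   difference is [s * s] times the value of ['D_w ('D_v G)] at an intermediate point. *)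
pose g (t : R) := G (x + t *: v + s *: w) - G (x + t *: v).
pose dg (t : R) := 'D_v G (x + t *: v + s *: w) - 'D_v G (x + t *: v).
have bnd (t : R) : t \in `[0, s]%R -> `|t| <= d.
  by rewrite in_itv /= => /andP[t0 ts]; rewrite ger0_norm// (le_trans ts).
have ss : `|s| <= d by rewrite gtr0_norm.
have z0 : `|0 : R| <= d by rewrite normr0 ltW.
have gd (t : R) : t \in `[0, s]%R -> is_derive t (1 : R) g (dg t).
  move=> /bnd ts; apply: is_deriveB.
    have -> : (fun t : R => G (x + t *: v + s *: w)) =
       (fun t : R => G (x + s *: w + t *: v)).
      by apply/funext => ?; rewrite addrAC.
    rewrite addrAC; apply: is_derive_line; rewrite addrAC.
    exact: (hd t s ts ss).1.1.
  apply: is_derive_line.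
  by have := (hd t 0 ts z0).1.1; rewrite scale0r addr0.
have cg := is_derive_within_continuous gd.
have [a] := MVT s0 (fun t ts => gd t (subset_itv_oo_cc ts)) cg.
move=> /subset_itv_oo_cc/bnd ad.
rewrite /g scale0r addr0 subr0 => ->.
have kd (t : R) : t \in `[0, s]%R ->
    is_derive t (1 : R) (fun t : R => 'D_v G (x + a *: v + t *: w))
      ('D_w ('D_v G) (x + a *: v + t *: w)).
  move=> /bnd ts; apply: is_derive_line; exact: (hd a t ad ts).1.2.
have ck := is_derive_within_continuous kd.
have [b] := MVT s0 (fun t ts => kd t (subset_itv_oo_cc ts)) ck.
move=> /subset_itv_oo_cc/bnd bd.
rewrite /dg scale0r addr0 subr0 => ->.
rewrite -mulrA -mulrBl normrM (ger0_norm (mulr_ge0 (ltW s0) (ltW s0))).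
apply: ler_wpM2r; first exact: mulr_ge0 (ltW s0) (ltW s0).
rewrite distrC.
exact: (hd a b ad bd).2.
Unshelve. all: by end_near. Qed.

Lemma derive_comm G x v w :
  (\forall y \near x, derivable G y v) ->
  (\forall y \near x, derivable ('D_v G) y w) ->
  {for x, continuous ('D_w ('D_v G))} ->
  (\forall y \near x, derivable G y w) ->
  (\forall y \near x, derivable ('D_w G) y v) ->
  {for x, continuous ('D_v ('D_w G))} ->
  'D_w ('D_v G) x = 'D_v ('D_w G) x.
Proof.
move=> a1 a2 a3 b1 b2 b3; apply/eqP; rewrite -subr_eq0 -normr_le0.
apply/ler_addgt0Pl => e e0; rewrite addr0.
have e20 : 0 < e / 2 by rewrite divr_gt0.
have A := mixed_difference_approx e20 a1 a2 a3.
have B := mixed_difference_approx e20 b1 b2 b3.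
have C : \forall s \near 0^'+, (0 : R) < s by exact: nbhs_right_gt.
have [s [[{}A {}B] s0]] := filter_ex (filterI (filterI A B) C).
move: s0 A B; rewrite /= [x + s *: w + s *: v]addrAC.
exact: mixed_difference_arith.
Qed.
End Lines.

Lemma near_eq_continuous (T W : topologicalType) (f g : T -> W) x :
  (\forall y \near x, f y = g y) -> {for x, continuous f} ->
  {for x, continuous g}.
Proof.
move=> fg cf; have /= E := nbhs_singleton fg.
change (g @ x --> g x); rewrite -E.
apply: cvg_trans cf; apply: near_eq_cvg.
exact: fg.
Qed.

Lemma near_open (T : topologicalType) (U : set T) : open U ->
  forall (P : T -> Prop) x, (forall y, U y -> P y) -> U x ->
  \forall y \near x, P y.
Proof. by move=> oU P x UP Ux; apply: filterS UP _; apply: open_nbhs_nbhs. Qed.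

Section Entries.
Variables (R : realType) (V : normedModType R) (a b : nat).
Implicit Types (F : V -> 'M[R]_(a, b)).

Lemma differentiable_entry F x i j : differentiable F x ->
  differentiable (fun y => F y i j) x.
Proof.
move=> dF.
exact: (@differentiable_comp _ _ _ _ F (fun N : 'M[R]_(a, b) => N i j : R) x dF
  (differentiable_coord _ _ _)).
Qed.

Lemma derive_entry F x v i j : derivable F x v ->
  'D_v (fun y => F y i j) x = ('D_v F x) i j.
Proof. by move=> dF; rewrite (derive_mx dF) mxE. Qed.

Lemma continuous_entry F x i j : {for x, continuous F} ->
  {for x, continuous (fun y => F y i j)}.
Proof.
move=> cF.
exact: (@continuous_comp _ _ _ F (fun N : 'M[R]_(a, b) => N i j) x cF
  (@coord_continuous _ _ _ _ _ _)).
Qed.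

Variables (U : set V) (oU : open U).

Lemma Ck_continuous (W : normedModType R) k (f : V -> W) x :
  Ck k U f -> U x -> {for x, continuous f}.
Proof.
case: k => [h|k [df _]] Ux; first exact: h.
exact/differentiable_continuous/df.
Qed.

Lemma derive2_entry F x v w i j : Ck 2 U F -> U x ->
  'D_w ('D_v (fun y => F y i j)) x = ('D_w ('D_v F) x) i j.
Proof.
move=> [dF CF] Ux; have [dDF _] := CF v.
rewrite -derive_entry; last exact/diff_derivable/dDF.
apply: near_eq_derive; near=> y; rewrite derive_entry//.
apply/diff_derivable/dF; near: y; exact: open_nbhs_nbhs.
Unshelve. all: by end_near. Qed.

Lemma derivable_derive_entry F v w i j y : Ck 2 U F -> U y ->
  derivable ('D_v (fun y => F y i j)) y w.
Proof.
move=> CF Uy; have [dF C1] := CF.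
apply: (@near_eq_derivable _ _ _ (fun y => 'D_v F y i j)).
  apply: (near_open oU) Uy => z Uz; rewrite derive_entry//.
  exact/diff_derivable/dF.
by apply/diff_derivable/differentiable_entry/(C1 v).1.
Qed.

(** [derive_comm] rests on the mean value theorem, which is scalar, so matrix-valued maps are
    treated entry by entry. *)
Lemma derive_comm_Ck F x v w : Ck 2 U F -> U x ->
  'D_w ('D_v F) x = 'D_v ('D_w F) x.
Proof.
move=> CF Ux; apply/matrixP => i j;
apply: etrans (esym (derive2_entry v w i j CF Ux)) _.
apply: etrans (derive2_entry w v i j CF Ux).
have c v1 w1 : {for x, continuous ('D_w1 ('D_v1 (fun y => F y i j)))}.
  apply: (@near_eq_continuous _ _ (fun y => 'D_w1 ('D_v1 F) y i j)).
    by apply: (near_open oU) Ux => z Uz; rewrite derive2_entry.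
  by apply: continuous_entry; apply: ((CF.2 v1).2 w1).
have d v1 y : U y -> derivable (fun y => F y i j) y v1.
  by move=> Uy; apply/diff_derivable/differentiable_entry/CF.1.
by apply: derive_comm => //; apply: (near_open oU) Ux => y Uy;
  [exact: d|exact: derivable_derive_entry|exact: d|
   exact: derivable_derive_entry].
Qed.
End Entries.

Section Partials.
Variables (R : realType) (n : nat) (W : normedModType R) (U : set 'rV[R]_n).
Hypothesis oU : open U.
Implicit Types f : 'rV[R]_n -> W.

Lemma derive_partials f x v : differentiable f x ->
  'D_v f x = \sum_j v 0 j *: partial j f x.
Proof.
move=> df; rewrite deriveE// {1}(row_sum_delta v) linear_sum.
by apply: eq_bigr => j _; rewrite linearZ /= /partial deriveE.
Qed.

Lemma derive2_partials f x v w : Ck 2 U f -> U x ->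
  'D_v ('D_w f) x = \sum_i \sum_j (v 0 i * w 0 j) *: partial i (partial j f) x.
Proof.
move=> Cf Ux; rewrite derive_partials; last exact: (Cf.2 w).1.
apply: eq_bigr => i _.
have -> : partial i ('D_w f) x =
    partial i (\sum_j (fun y => w 0 j *: partial j f y)) x.
  apply: near_eq_derive; apply: (near_open oU) Ux => // y Uy.
  by rewrite derive_partials ?fct_sumE//; exact: Cf.1.
have dp j : derivable (partial j f) x (delta_mx 0 i).
  by apply/diff_derivable/(Cf.2 _).1.
rewrite /partial derive_sum => [|j]; last exact/derivableZ/dp.
rewrite scaler_sumr; apply: eq_bigr => j _.
have /= -> := deriveZ (w 0 j) (dp j).
by rewrite scalerA.
Qed.
End Partials.

(** * Linear algebra *)

Section Edot.
Variables (R : realType) (N : nat).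
Implicit Types u v w : 'rV[R]_N.

Lemma edotE u v : edot u v = \sum_k u 0 k * v 0 k.
Proof. by rewrite /edot mxE; apply: eq_bigr => k _; rewrite mxE. Qed.

Lemma edotC u v : edot u v = edot v u.
Proof. by rewrite !edotE; apply: eq_bigr => k _; rewrite mulrC. Qed.

Lemma edotZl (k : R) u v : edot (k *: u) v = k * edot u v.
Proof. by rewrite /edot -scalemxAl mxE. Qed.

Lemma edot_suml (I : Type) (r : seq I) (P : pred I) (F : I -> 'rV[R]_N) v :
  edot (\sum_(i <- r | P i) F i) v = \sum_(i <- r | P i) edot (F i) v.
Proof. by rewrite /edot mulmx_suml summxE. Qed.

Lemma edotBl u v w : edot (u - v) w = edot u w - edot v w.
Proof. by rewrite /edot mulmxBl !mxE. Qed.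

Lemma edot_ge0 u : 0 <= edot u u.
Proof. by rewrite edotE sumr_ge0// => k _; rewrite -expr2 sqr_ge0. Qed.

Lemma edot_eq0 u : (edot u u == 0) = (u == 0).
Proof.
apply/eqP/eqP => [|->]; last by rewrite /edot mul0mx mxE.
rewrite edotE => /eqP; rewrite psumr_eq0 => [|k _]; last first.
  by rewrite -expr2 sqr_ge0.
move=> /allP h; apply/rowP => k; rewrite mxE.
by have := h k (mem_index_enum _); rewrite mulf_eq0 orbb => /eqP.
Qed.

Lemma enorm_sqr u : enorm u ^+ 2 = edot u u.
Proof. by rewrite sqr_sqrtr// edot_ge0. Qed.
End Edot.

Section OrthPart.
Variables (R : realType) (k N : nat) (A : 'M[R]_(k, N)).
Implicit Types y z : 'rV[R]_N.

(** With [kermx_tr_full], this makes [orth_part] a genuine orthogonal projection. A vector [z *m A]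
    killed by [A^T] is orthogonal to itself, hence zero because [edot] is positive definite. *)
Lemma kermx_tr_disjoint : (kermx A^T :&: <<A>>)%MS = 0.
Proof.
apply/eqP/rowV0P => v; rewrite sub_capmx genmxE => /andP[/sub_kermxP vA].
move=> /submxP[z vE]; apply/eqP; rewrite -edot_eq0 /edot {2}vE trmx_mul.
by rewrite mulmxA vA mul0mx mxE.
Qed.

Lemma kermx_tr_full y : (y <= kermx A^T + <<A>>)%MS.
Proof.
suff : row_full (kermx A^T + <<A>>)%MS by move=> /submx_full ->.
rewrite /row_full mxrank_disjoint_sum; last exact: kermx_tr_disjoint.
by rewrite mxrank_ker mxrank_tr genmxE subnK// rank_leq_col.
Qed.

Lemma orth_part_perp y : orth_part A y *m A^T = 0.
Proof. exact/sub_kermxP/proj_mx_sub. Qed.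

Lemma sub_orth_part y : (y - orth_part A y <= A)%MS.
Proof.
have /= := add_proj_mx kermx_tr_disjoint (kermx_tr_full y).
rewrite /orth_part => {1}<-; rewrite addrC addKr.
by rewrite -(genmxE A) proj_mx_sub.
Qed.

Lemma orth_part_id y : y *m A^T = 0 -> orth_part A y = y.
Proof. by move=> /sub_kermxP; exact: proj_mx_id kermx_tr_disjoint. Qed.

Lemma orth_part_tangent y : (y <= A)%MS -> orth_part A y = 0.
Proof.
by move=> yA; apply: proj_mx_0 kermx_tr_disjoint _; rewrite genmxE.
Qed.

Lemma orth_partB y z : orth_part A (y - z) = orth_part A y - orth_part A z.
Proof. exact: mulmxBl. Qed.

Lemma orth_partZ (a : R) y : orth_part A (a *: y) = a *: orth_part A y.
Proof. by rewrite /orth_part scalemxAl. Qed.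

Lemma edot_perp_tangent y z : y *m A^T = 0 -> (z <= A)%MS -> edot y z = 0.
Proof.
by move=> yA /submxP[w ->]; rewrite /edot trmx_mul mulmxA yA mul0mx mxE.
Qed.

Lemma edot_orth_part y z : y *m A^T = 0 -> edot y (orth_part A z) = edot y z.
Proof.
move=> yA; apply/eqP; rewrite eq_sym -subr_eq0 edotC (edotC y) -edotBl edotC.
by rewrite (edot_perp_tangent yA)// sub_orth_part.
Qed.
End OrthPart.

(** For the one-row matrix [x] this is the projection onto the tangent space at [x] of the sphere
    through [x], the inner projection of [sphere_sff]. *)
Lemma orth_part_row (R : realType) N (x y : 'rV[R]_N) : x != 0 ->
  orth_part x y = y - (edot y x / edot x x) *: x.
Proof.
rewrite -edot_eq0 => x0; set z := _ *: x.
have -> : orth_part x y = orth_part x (y - z).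
  by rewrite orth_partB (@orth_part_tangent _ _ _ _ z) ?subr0// scalemx_sub.
apply: orth_part_id; rewrite mulmxBl -scalemxAl.
apply/rowP => i; rewrite ord1 [LHS]mxE [X in _ + X]mxE [X in _ - X]mxE.
by rewrite -/(edot y x) -/(edot x x) divfK// subrr mxE.
Qed.

Lemma posdef_unitmx (R : realType) n (g : 'M[R]_n) :
  (forall v : 'rV[R]_n, v != 0 -> 0 < (v *m g *m v^T) 0 0) -> g \in unitmx.
Proof.
move=> gpos; rewrite -row_free_unit -kermx_eq0; apply/rowV0P => v.
move=> /sub_kermxP vg.
by apply: contraTeq isT => /gpos; rewrite vg mul0mx mxE ltxx.
Qed.

Section Gram.
Variables (R : realType) (n N : nat) (J : 'M[R]_(n, N)).
Let g := J *m J^T.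
Hypothesis gpos : forall v : 'rV[R]_n, v != 0 -> 0 < (v *m g *m v^T) 0 0.

(* An explicit square root of the inverse metric: it turns the principal part
   of the Laplacian into a sum of second directional derivatives. *)
Lemma invmx_gram : invmx g = (invmx g *m J) *m (invmx g *m J)^T.
Proof.
have gT : (invmx g)^T = invmx g.
  by rewrite trmx_inv /g trmx_mul trmxK.
rewrite trmx_mul gT !mulmxA -(mulmxA _ J) -/g.
by rewrite mulVmx ?(posdef_unitmx gpos)// mul1mx.
Qed.

(** The entry is the squared length of a row of [invmx g *m J]; a zero row there would give a zero
    row in the invertible matrix [invmx g]. It is the leading coefficient in [K] when the operator
    is applied to the barrier. *)
Lemma invmx_gram_diag_gt0 i : 0 < invmx g i i.
Proof.
set B := invmx g *m J.
have E : invmx g i i = edot (row i B) (row i B).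
  by rewrite invmx_gram -/B edotE mxE; apply: eq_bigr => k _; rewrite !mxE.
rewrite E lt_neqAle edot_ge0 andbT eq_sym edot_eq0; apply/eqP => B0.
have : row i (invmx g) = 0 by rewrite invmx_gram -/B row_mul B0 mul0mx.
move=> /(congr1 (mulmx^~ g)).
rewrite -row_mul mulVmx ?(posdef_unitmx gpos)// mul0mx.
by move=> /rowP/(_ i); rewrite !mxE eqxx => /eqP; rewrite oner_eq0.
Qed.

Lemma mxtrace_invmx_mul : \sum_i \sum_j invmx g i j * g i j = n%:R.
Proof.
have gT : g^T = g by rewrite /g trmx_mul trmxK.
rewrite -[RHS](@mxtrace1 R n) -(mulVmx (posdef_unitmx gpos)).
by apply: eq_bigr => i _; rewrite mxE; apply: eq_bigr => j _;
  rewrite -[in LHS]gT [g^T i j]mxE gT.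
Qed.
End Gram.

(** * The weak maximum principle *)

Lemma combination_le0 (R : realDomainType) (s1 s2 s3 t1 t2 t3 e : R) :
  s1 - s2 + e * s3 <= 0 -> t1 - t2 + e * t3 = 0 ->
  (s1 - t1) - (s2 - t2) + e * (s3 - t3) <= 0.
Proof. move=> h1 h2; lra. Qed.

Section Elliptic.
Variables (R : realType) (n : nat).
Implicit Types f : 'rV[R]_n -> R.

(** The coefficients are frozen values rather than functions, since the maximum principle evaluates
    the operator at a single point. *)
Definition elliptic (a : 'M[R]_n) (b : 'I_n -> R) f (x : 'rV[R]_n) : R :=
  \sum_i \sum_j a i j * partial i (partial j f) x - \sum_k b k * partial k f x.

(** The factorization removes the mixed derivatives, whose sign at a maximum is unknown, in favour
    of pure ones along the columns of [B]. *)
Lemma elliptic_gram_second_derivatives N (B : 'M[R]_(n, N)) (b : 'I_n -> R)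
    (U : set 'rV[R]_n) f x :
  open U -> Ck 2 U f -> U x ->
  elliptic (B *m B^T) b f x =
  \sum_k 'D_((col k B)^T) ('D_((col k B)^T) f) x - \sum_k b k * partial k f x.
Proof.
move=> oU Cf Ux; congr (_ - _).
under [RHS]eq_bigr do rewrite (derive2_partials oU)//.
rewrite [RHS]exchange_big; apply: eq_bigr => i _.
rewrite [RHS]exchange_big; apply: eq_bigr => j _.
rewrite mxE mulr_suml; apply: eq_bigr => k _.
by rewrite !mxE.
Qed.

Lemma is_derive_combination f g h (e : R) x v :
  derivable f x v -> derivable g x v -> derivable h x v ->
  is_derive x v (f - g + e *: h) ('D_v f x - 'D_v g x + e * 'D_v h x).
Proof.
move=> df dg dh.
by apply: is_deriveD; [apply: is_deriveB|apply: is_deriveZ]; apply: derivableP.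
Qed.

Lemma derive2_combination (U : set 'rV[R]_n) f g h (e : R) x v :
  open U -> Ck 2 U f -> Ck 2 U g -> Ck 2 U h -> U x ->
  [/\ \forall y \near x, derivable (f - g + e *: h) y v,
      derivable ('D_v (f - g + e *: h)) x v,
      'D_v (f - g + e *: h) x = 'D_v f x - 'D_v g x + e * 'D_v h x &
      'D_v ('D_v (f - g + e *: h)) x =
      'D_v ('D_v f) x - 'D_v ('D_v g) x + e * 'D_v ('D_v h) x].
Proof.
move=> oU Cf Cg Ch Ux.
have DG y : U y -> is_derive y v (f - g + e *: h)
    ('D_v f y - 'D_v g y + e * 'D_v h y).
  move=> Uy; apply: is_derive_combination; apply: diff_derivable;
    by [exact: Cf.1|exact: Cg.1|exact: Ch.1].
have D2 : is_derive x v ('D_v f - 'D_v g + e *: 'D_v h)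
    ('D_v ('D_v f) x - 'D_v ('D_v g) x + e * 'D_v ('D_v h) x).
  apply: is_derive_combination; apply: diff_derivable;
    by [exact: (Cf.2 v).1|exact: (Cg.2 v).1|exact: (Ch.2 v).1].
have nE : \forall y \near x,
    ('D_v f - 'D_v g + e *: 'D_v h) y = 'D_v (f - g + e *: h) y.
  by apply: (near_open oU) Ux => y /DG[_ ->].
have [D2d D2E] := near_eq_is_derive nE D2.
split=> //.
- by apply: (near_open oU) Ux => y /DG[].
- by have [_ ->] := DG x Ux.
Qed.

(** In the application [f] is the function to be proved subharmonic, [g] the harmonic competitor and
    [e * h] the barrier. At the maximum the first-order terms cancel and each pure second derivative
    of the combination is nonpositive. *)
Lemma elliptic_max_principle N (B : 'M[R]_(n, N)) (b : 'I_n -> R)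
    (U : set 'rV[R]_n) f g h (e : R) x :
  open U -> Ck 2 U f -> Ck 2 U g -> Ck 2 U h -> U x ->
  (forall y, U y -> f y - g y + e * h y <= f x - g x + e * h x) ->
  elliptic (B *m B^T) b f x - elliptic (B *m B^T) b g x
    + e * elliptic (B *m B^T) b h x <= 0.
Proof.
move=> oU Cf Cg Ch Ux xmax.
have max_v v : 'D_v f x - 'D_v g x + e * 'D_v h x = 0 /\
    'D_v ('D_v f) x - 'D_v ('D_v g) x + e * 'D_v ('D_v h) x <= 0.
  have [d1 d2 <- <-] := derive2_combination e v oU Cf Cg Ch Ux.
  apply: second_derivative_at_max d1 d2.
  exact: (near_open oU).
rewrite (elliptic_gram_second_derivatives B b oU Cf Ux).
rewrite (elliptic_gram_second_derivatives B b oU Cg Ux).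
rewrite (elliptic_gram_second_derivatives B b oU Ch Ux).
apply: combination_le0.
  rewrite -sumrB mulr_sumr -big_split /=.
  by apply: sumr_le0 => k _; exact: (max_v _).2.
rewrite -sumrB mulr_sumr -big_split /= big1// => k _.
by rewrite mulrCA -mulrBr -mulrDr (max_v (delta_mx 0 k)).1 mulr0.
Qed.
End Elliptic.

Section ExpCoord.
Variables (R : realType) (n : nat) (K : R) (i0 : 'I_n).

Definition exp_coord (y : 'rV[R]_n) : R := expR (K * y 0 i0).

Lemma is_diff_coord (y : 'rV[R]_n) :
  is_diff y (fun z : 'rV[R]_n => K * z 0 i0) (fun v : 'rV[R]_n => K * v 0 i0).
Proof.
have d1 : differentiable (fun z : 'rV[R]_n => z 0 i0) y.
  exact: differentiable_coord.
have d2 := differentiableZ K d1.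
apply: DiffDef; first exact: d2.
apply/funext => v; rewrite -deriveE; last exact: d2.
have -> : 'D_v (fun z : 'rV[R]_n => K * z 0 i0) y =
    K * 'D_v (fun z : 'rV[R]_n => z 0 i0) y.
  apply: (@deriveZ R _ _ (fun z : 'rV[R]_n => z 0 i0) K y v).
  exact: diff_derivable.
by rewrite (@derive_entry R _ 1 n id y v 0 i0) ?derive_id.
Qed.

Lemma differentiable_exp_coord y : differentiable exp_coord y.
Proof.
have [d1 _] := is_diff_coord y.
have d2 : differentiable (@expR R) (K * y 0 i0).
  exact/derivable1_diffP/derivable_expR.
exact: (@differentiable_comp R 'rV[R]_n R R (fun z => K * z 0 i0) (@expR R) y
  d1 d2).
Qed.

Lemma derive_exp_coord v : 'D_v exp_coord = (K * v 0 i0) *: exp_coord.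
Proof.
apply/funext => y; rewrite deriveE; last exact: differentiable_exp_coord.
have [d1 E1] := is_diff_coord y.
have d2 : differentiable (@expR R) (K * y 0 i0).
  exact/derivable1_diffP/derivable_expR.
rewrite (@diff_comp R 'rV[R]_n R R (fun z => K * z 0 i0) (@expR R) y d1 d2) /=.
rewrite E1 deriv1E; last exact: derivable_expR.
by rewrite derive1E derive_val.
Qed.

Lemma derive2_exp_coord (k : R) w :
  'D_w (k *: exp_coord) = k *: ((K * w 0 i0) *: exp_coord).
Proof.
have d y : derivable exp_coord y w.
  exact/diff_derivable/differentiable_exp_coord.
rewrite -(derive_exp_coord w); apply/funext => y.
exact: (deriveZ k (d y)).
Qed.

Lemma Ck2_exp_coord U : Ck 2 U exp_coord.
Proof.
split=> [y _|v]; first exact: differentiable_exp_coord.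
rewrite derive_exp_coord; split=> [y _|w].
  exact/differentiableZ/differentiable_exp_coord.
rewrite derive2_exp_coord.
move=> y _; apply: differentiable_continuous.
by do 2 apply: differentiableZ; exact: differentiable_exp_coord.
Qed.

Lemma elliptic_exp_coord a b y :
  elliptic a b exp_coord y = K * (K * a i0 i0 - b i0) * exp_coord y.
Proof.
have pE k : partial k exp_coord = (K * (k == i0)%:R) *: exp_coord.
  rewrite -[LHS]/('D_(delta_mx 0 k) exp_coord) derive_exp_coord.
  by rewrite mxE eqxx eq_sym.
have p k : partial k exp_coord y = K * (k == i0)%:R * exp_coord y.
  by rewrite pE.
have pp i j : partial i (partial j exp_coord) y =
    K * (j == i0)%:R * (K * (i == i0)%:R * exp_coord y).
  have /(congr1 (@^~ y)) := derive2_exp_coord (K * (j == i0)%:R) (delta_mx 0 i).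
  by rewrite mxE eqxx (eq_sym i0) -pE; apply.
have S1 : \sum_i \sum_j a i j * partial i (partial j exp_coord) y =
    a i0 i0 * (K * (K * exp_coord y)).
  rewrite (big_only1 i0)// => [|i ii0 _]; last first.
    by apply: big1 => j _; rewrite pp (negPf ii0) mulr0 mul0r !mulr0.
  rewrite (big_only1 i0)// => [|j jj0 _].
    by rewrite pp eqxx mulr1.
  by rewrite pp (negPf jj0) mulr0 mul0r mulr0.
have S2 : \sum_k b k * partial k exp_coord y = b i0 * (K * exp_coord y).
  rewrite (big_only1 i0)// => [|k kk0 _]; first by rewrite p eqxx mulr1.
  by rewrite p (negPf kk0) mulr0 mul0r mulr0.
by rewrite /elliptic S1 S2; ring.
Qed.
End ExpCoord.

(** * Continuity of determinants and inverse matrices *)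

Section Continuity.
Variables (R : realType) (T : topologicalType) (x : T).

Lemma continuous_sum (I : Type) (r : seq I) (F : I -> T -> R) :
  (forall i, {for x, continuous (F i)}) ->
  {for x, continuous (fun y => \sum_(i <- r) F i y)}.
Proof.
move=> h; apply: cvg_big => [|i _]; last exact: h.
exact: add_continuous.
Qed.

Lemma continuous_prod (I : Type) (r : seq I) (F : I -> T -> R) :
  (forall i, {for x, continuous (F i)}) ->
  {for x, continuous (fun y => \prod_(i <- r) F i y)}.
Proof.
move=> h; apply: cvg_big => [|i _]; last exact: h.
exact: mul_continuous.
Qed.

Lemma continuous_det n (A : T -> 'M[R]_n) :
  (forall i j, {for x, continuous (fun y => A y i j)}) ->
  {for x, continuous (fun y => \det (A y))}.
Proof.
move=> h; apply: continuous_sum => s; apply: continuousM.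
  exact: cst_continuous.
by apply: continuous_prod => i; exact: h.
Qed.

Lemma continuous_invmx n (A : T -> 'M[R]_n) i j :
  (forall i j, {for x, continuous (fun y => A y i j)}) ->
  A x \in unitmx -> {for x, continuous (fun y => invmx (A y) i j)}.
Proof.
move=> h Ax; have detc := continuous_det h.
have det0 : \det (A x) != 0 by rewrite -unitfE -unitmxE.
(* [invmx] is given by cofactors only on invertible matrices and returns its argument elsewhere, so
   invertibility is first spread to a neighbourhood. *)
have nu : \forall y \near x, A y \in unitmx.
  have : \forall y \near x, \det (A y) != 0.
    by apply: cvgr_neq0 detc det0.
  by apply: filterS => y; rewrite unitmxE unitfE.
apply: (@near_eq_continuous _ _
  (fun y => (\det (A y))^-1 * cofactor (A y) j i)).
  by apply: filterS nu => y yu; rewrite /invmx yu !mxE.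
apply: continuousM; first exact: continuousV.
apply: continuousM; first exact: cst_continuous.
apply: continuous_det => k l.
apply: near_eq_continuous (h (lift j k) (lift i l)).
by near=> y; rewrite !mxE.
Unshelve. all: by end_near. Qed.
End Continuity.

Section Charts.
Variables (R : realType) (n : nat) (T : topologicalType) (c : chart R n T).

Lemma open_coord_image (D : set T) : open D ->
  open (Defs.coord c @` (dom c `&` D)).
Proof.
move=> oD; rewrite openE => _ [p [cp Dp] <-].
have U : \forall y \near Defs.coord c p, cimage c y.
  by apply: open_nbhs_nbhs; split; [exact: cimage_open|exists p].
have V : \forall y \near Defs.coord c p, D (param c y).
  apply: (param_continuous cp); rewrite paramK//.
  exact: open_nbhs_nbhs.
apply: filterS2 U V => y [q cq <-]; rewrite paramK// => Dq.
by exists q.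
Qed.

Lemma cimage_param x : cimage c x ->
  dom c (param c x) /\ Defs.coord c (param c x) = x.
Proof. by move=> [p cp <-]; rewrite paramK. Qed.
End Charts.

(** * The Laplacian as an elliptic operator with continuous coefficients *)

Section LaplacianInChart.
Variables (R : realType) (n : nat) (M : riemannianManifold R n).
Variable c : chart R n M.

Definition drift (x : 'rV[R]_n) (k : 'I_n) : R :=
  \sum_i \sum_j invmx (metric c x) i j * christoffel c k i j x.

Lemma laplacianE u x : laplacian c u x =
  elliptic (invmx (metric c x)) (drift x) (u \o param c) x.
Proof.
rewrite /laplacian /elliptic.
have -> : \sum_k drift x k * partial k (u \o param c) x =
  \sum_i \sum_j invmx (metric c x) i j *
    \sum_k christoffel c k i j x * partial k (u \o param c) x.
  under eq_bigr do rewrite mulr_suml.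
  rewrite exchange_big; apply: eq_bigr => i _ /=.
  under eq_bigr do rewrite mulr_suml.
  rewrite exchange_big; apply: eq_bigr => j _ /=.
  by rewrite mulr_sumr; apply: eq_bigr => k _; rewrite -mulrA.
rewrite -sumrB; apply: eq_bigr => i _; rewrite -sumrB; apply: eq_bigr => j _.
by rewrite mulrBr.
Qed.

Hypothesis ac : atlas c.
Local Notation U := (cimage c).

Lemma metric_unitmx x : U x -> metric c x \in unitmx.
Proof. by move=> Ux; apply: posdef_unitmx; exact: metric_pos. Qed.

Lemma continuous_metric_entry x i j : U x ->
  {for x, continuous (fun y => metric c y i j)}.
Proof.
by move=> Ux; apply: continuous_entry; apply: (metric_smooth ac 0).
Qed.

Lemma continuous_partial_metric x i j l : U x ->
  {for x, continuous (fun y => partial i (fun z => metric c z j l) y)}.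
Proof.
move=> Ux; have [dm cm] := metric_smooth ac 1.
apply: (@near_eq_continuous _ _ (fun y => 'D_(delta_mx 0 i) (metric c) y j l)).
  apply: (near_open (@cimage_open _ _ _ c)) Ux => y Uy.
  by rewrite /partial derive_entry//; apply/diff_derivable/dm.
by apply: continuous_entry; apply: cm.
Qed.

Lemma continuous_invmx_metric x i j : U x ->
  {for x, continuous (fun y => invmx (metric c y) i j)}.
Proof.
move=> Ux; apply: continuous_invmx; last exact: metric_unitmx.
by move=> k l; exact: continuous_metric_entry.
Qed.

Lemma continuous_drift x k : U x -> {for x, continuous (drift ^~ k)}.
Proof.
move=> Ux; apply: continuous_sum => i; apply: continuous_sum => j.
apply: continuousM; first exact: continuous_invmx_metric.
apply: continuousM; first exact: cst_continuous.
apply: continuous_sum => l; apply: continuousM.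
  exact: continuous_invmx_metric.
apply: continuousB; last exact: continuous_partial_metric.
by apply: continuousD; exact: continuous_partial_metric.
Qed.
End LaplacianInChart.

Lemma Ck_subset (R : realType) (V W : normedModType R) k (U U' : set V)
  (f : V -> W) : U' `<=` U -> Ck k U f -> Ck k U' f.
Proof.
move=> UU'; elim: k f => [f h x /UU'|k IH f [df cf]]; first exact: h.
by split=> [x /UU'|v]; [exact: df|exact/IH/cf].
Qed.

(** * Comparison with harmonic functions *)

Section Subharmonic.
Variables (R : realType) (n N : nat) (M : riemannianManifold R n).
Variable X : M -> 'rV[R]_N.
Hypothesis X_isometric : isometric_immersion X.

Lemma metric_gram c x : atlas c -> cimage c x ->
  metric c x = frame (X \o param c) x *m (frame (X \o param c) x)^T.
Proof.
move=> ac Ux; apply/matrixP => i j; rewrite ((X_isometric ac).2 x Ux) edotE mxE.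
by apply: eq_bigr => k _; rewrite !mxE.
Qed.

Lemma gram_posdef c x : atlas c -> cimage c x -> forall v : 'rV[R]_n, v != 0 ->
  0 < (v *m (frame (X \o param c) x *m (frame (X \o param c) x)^T) *m v^T) 0 0.
Proof. by move=> ac Ux v v0; rewrite -metric_gram//; exact: metric_pos. Qed.

Lemma laplacian_max_principle (c : chart R n M) (D : set M) (u h : M -> R)
    (phi : 'rV[R]_n -> R) (e : R) p :
  atlas c -> open D -> dom c p -> D p ->
  Ck 2 (Defs.coord c @` (dom c `&` D)) (u \o param c) ->
  Ck 2 (Defs.coord c @` (dom c `&` D)) (h \o param c) ->
  Ck 2 (Defs.coord c @` (dom c `&` D)) phi ->
  (forall q, dom c q -> D q -> u q - h q + e * phi (Defs.coord c q)
     <= u p - h p + e * phi (Defs.coord c p)) ->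
  laplacian c u (Defs.coord c p) - laplacian c h (Defs.coord c p)
  + e * elliptic (invmx (metric c (Defs.coord c p))) (drift c (Defs.coord c p))
          phi (Defs.coord c p) <= 0.
Proof.
move=> ac oD cp Dp Cu Ch Cphi pmax.
have Up : cimage c (Defs.coord c p) by exists p.
rewrite !laplacianE metric_gram// invmx_gram; last exact: gram_posdef.
apply: (elliptic_max_principle _ _ (open_coord_image oD) Cu Ch Cphi).
  by exists p.
by move=> _ [q [cq Dq] <-] /=; rewrite !paramK//; exact: pmax.
Qed.

Variable i0 : 'I_n.

(* [elliptic_exp_coord] is positive as soon as [K > b i0 / a i0 i0], and this
   quotient is continuous, hence bounded on compact sets. *)
Lemma exists_barrier (c : chart R n M) (A : set M) :
  atlas c -> compact A -> A `<=` dom c -> exists K : R, forall p, A p ->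
    0 < elliptic (invmx (metric c (Defs.coord c p))) (drift c (Defs.coord c p))
          (exp_coord K i0) (Defs.coord c p).
Proof.
move=> ac cA Ac; have [->|/set0P A0] := eqVneq A set0; first by exists 0.
have a_gt0 x : cimage c x -> 0 < invmx (metric c x) i0 i0.
  move=> Ux; rewrite metric_gram//; apply: invmx_gram_diag_gt0.
  exact: gram_posdef.
pose q (x : 'rV[R]_n) := drift c x i0 * (invmx (metric c x) i0 i0)^-1.
have qx x : cimage c x -> {for x, continuous q}.
  move=> Ux; apply: continuousM; first exact: continuous_drift.
  apply: continuousV; last exact: continuous_invmx_metric.
  by rewrite gt_eqF// a_gt0.
have qc : {within A, continuous (q \o Defs.coord c)}.
  apply: continuous_in_subspaceT => p; rewrite inE => /Ac cp.
  apply: continuous_comp; first exact: Defs.coord_continuous.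
  by apply: qx; exists p.
have [p1 _ p1max] := compact_EVT_max A0 cA qc.
(* [K] has to exceed the maximum of [q] and also be positive, because [elliptic_exp_coord] has the
   factor [K] besides [K * a i0 i0 - b i0]. *)
exists (`|q (Defs.coord c p1)| + 1) => p Ap.
have Up : cimage c (Defs.coord c p) by exists p => //; exact: Ac.
have ap := a_gt0 _ Up.
rewrite elliptic_exp_coord; apply: mulr_gt0; last exact: expR_gt0.
apply: mulr_gt0; first by rewrite ltr_wpDl.
rewrite subr_gt0 -ltr_pdivrMr//.
apply: le_lt_trans (p1max p _) _; first by rewrite inE.
by rewrite /= (le_lt_trans (ler_norm _))// ltrDl.
Qed.

(** The perturbed difference [W] has a strictly positive Laplacian in [D], so its maximum over the
    compact set [closure D] lies outside [D], where [u <= h] by assumption. *)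
Lemma subharmonic_laplacian_ge0 (u : M -> R) :
  continuous u ->
  (forall c, atlas c -> Ck 2 (cimage c) (u \o param c)) ->
  (forall c, atlas c -> forall p, dom c p ->
    0 <= laplacian c u (Defs.coord c p)) ->
  subharmonic u.
Proof.
move=> cu Cu Lu; split=> // c D ac oD cD Dc h ch harm uh p Dp.
have DA : D `<=` closure D by exact: subset_closure.
have [K Kpos] := exists_barrier ac cD Dc.
pose phi := exp_coord K i0; pose phiM (q : M) := phi (Defs.coord c q).
have phic : {within closure D, continuous phiM}.
  apply: continuous_in_subspaceT => q; rewrite inE => /Dc cq.
  apply: continuous_comp; first exact: Defs.coord_continuous.
  exact/differentiable_continuous/differentiable_exp_coord.
have A0 : closure D !=set0 by exists p; exact: DA.
have [p2 _ p2max] := compact_EVT_max A0 cD phic.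
have B0 : 0 < phiM p2 by exact: expR_gt0.
apply/ler_addgt0Pl => e e0.
(* Dividing by the maximum of the barrier keeps the perturbation [e' * phiM] at most [e] on
   [closure D]. *)
pose e' := e / phiM p2; have e'0 : 0 < e' by exact: divr_gt0.
pose W (q : M) := u q - h q + e' * phiM q.
have Wc : {within closure D, continuous W}.
  move=> q; apply: cvgD.
    by apply: cvgB; [exact: (continuous_subspaceT cu)|exact: ch].
  by apply: cvgM; [exact: cvg_cst|exact: phic].
have [p0] := compact_EVT_max A0 cD Wc; rewrite inE => Dp0 p0max.
have W0max q : closure D q -> W q <= W p0.
  by move=> Dq; apply: p0max; rewrite inE.
have phi_e : e' * phiM p0 <= e.
  rewrite -[leRHS](@divfK _ (phiM p2)) ?gt_eqF// ler_pM2l//.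
  by apply: p2max; rewrite inE.
(* If the maximum is on the boundary, [u p0 <= h p0] and [W p <= W p0] give
   [u p - h p < e' * phiM p0 <= e]. *)
have [D0|nD0] := pselect (D p0); last first.
  have u0 := uh p0 (conj Dp0 nD0).
  have Wp := W0max p (DA _ Dp).
  have phip : 0 < e' * phiM p by apply: mulr_gt0 => //; exact: expR_gt0.
  move: Wp; rewrite /W => Wp; lra.
have [Ch Lh] := harm c ac.
have cp0 := Dc _ Dp0.
have sub : Defs.coord c @` (dom c `&` D) `<=` cimage c.
  by move=> _ [q [cq _] <-]; exists q.
have := laplacian_max_principle ac oD cp0 D0 (Ck_subset sub (Cu c ac)) Ch
  (Ck2_exp_coord K i0 _) (fun q cq Dq => W0max q (DA _ Dq)).
rewrite (Lh _ cp0 D0) subr0 leNgt => /negP[].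
by rewrite ltr_wpDl ?Lu// mulr_gt0// Kpos.
Qed.
End Subharmonic.

(** * Functions of class C^k *)

(** The first-order expansion of [f] at [x] involves only values near [x], so ['d f x] also serves
    for [g], and [diff_unique] identifies it with ['d g x]. *)
Lemma near_eq_differentiable (R : realType) (V W : normedModType R)
    (f g : V -> W) x :
  (\forall y \near x, f y = g y) -> differentiable f x -> differentiable g x.
Proof.
move=> fg /diff_locallyP[df fE].
have gE : g \o shift x = cst (g x) + 'd f x +o_ (0 : V) id.
  apply/eqaddoP => _/posnumP[e].
  have /eqaddoP /(_ e%:num) /(_ [gt0 of e%:num]) := fE.
  have /= fgx := nbhs_singleton fg.
  have nfg : \forall y \near (0 : V), f (y + x) = g (y + x).
    by move: fg; rewrite (near_shift 0)/= subr0.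
  apply: filterS2 nfg => y fgy; rewrite -fgx.
  have -> : (f \o shift x - (cst (f x) + 'd f x)) y =
      (g \o shift x - (cst (f x) + 'd f x)) y.
    by congr (_ - _); exact: fgy.
  exact.
apply/diff_locallyP; rewrite (diff_unique df gE); split => //.
Qed.

Section CkAlgebra.
Variables (R : realType) (V : normedModType R) (U : set V).
Hypothesis oU : open U.

(** Differentiation rules hold only on [U], whereas [Ck] speaks of the total functions ['D_v f]. As
    [U] is open, equality on [U] is equality near each of its points, and so passes to
    derivatives. *)
Lemma Ck_congr (W : normedModType R) k (f g : V -> W) :
  (forall x, U x -> f x = g x) -> Ck k U f -> Ck k U g.
Proof.
elim: k f g => [f g fg cf x Ux|k IH f g fg [df cf]].
  by apply: near_eq_continuous (cf x Ux); exact: (near_open oU).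
split=> [x Ux|v].
  by apply: near_eq_differentiable (df x Ux); exact: (near_open oU).
apply: IH (cf v) => x Ux; apply: near_eq_derive; exact: (near_open oU).
Qed.

Lemma Ck_weak (W : normedModType R) k (f : V -> W) : Ck k.+1 U f -> Ck k U f.
Proof.
elim: k f => [|k IH] f [df cf].
  by move=> x Ux; apply/differentiable_continuous/df.
by split=> // v; apply: IH.
Qed.

Lemma CkD (W : normedModType R) k (f g : V -> W) :
  Ck k U f -> Ck k U g -> Ck k U (fun x => f x + g x).
Proof.
elim: k f g => [f g cf cg x Ux|k IH f g [df cf] [dg cg]].
  exact: (cvgD (cf x Ux) (cg x Ux)).
split=> [x Ux|v]; first exact: (differentiableD (df x Ux) (dg x Ux)).
apply: Ck_congr (IH _ _ (cf v) (cg v)) => x Ux.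
by apply/esym/deriveD; apply: diff_derivable; [exact: df|exact: dg].
Qed.

Lemma CkZ (W : normedModType R) k (s : R) (f : V -> W) :
  Ck k U f -> Ck k U (fun x => s *: f x).
Proof.
elim: k f => [f cf x Ux|k IH f [df cf]].
  by apply: cvgZl_tmp; exact: cf.
split=> [x Ux|v]; first exact: (differentiableZ s (df x Ux)).
apply: Ck_congr (IH _ (cf v)) => x Ux.
by apply/esym/deriveZ; apply: diff_derivable; exact: df.
Qed.

Variable N : nat.
Implicit Types F G : V -> 'rV[R]_N.

Lemma differentiable_edot F G x : differentiable F x -> differentiable G x ->
  differentiable (fun z => edot (F z) (G z)) x.
Proof.
move=> dF dG.
have -> : (fun z => edot (F z) (G z)) = \sum_k (fun z => F z 0 k * G z 0 k).
  by apply/funext => z; rewrite edotE fct_sumE.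
apply: differentiable_sum => k.
by apply: differentiableM; exact: differentiable_entry.
Qed.

Lemma derive_edot F G x v : derivable F x v -> derivable G x v ->
  'D_v (fun z => edot (F z) (G z)) x =
  edot ('D_v F x) (G x) + edot (F x) ('D_v G x).
Proof.
move=> dF dG.
have -> : (fun z => edot (F z) (G z)) = \sum_k (fun z => F z 0 k * G z 0 k).
  by apply/funext => z; rewrite edotE fct_sumE.
have dFk k : derivable (fun z => F z 0 k) x v.
  exact: ((derivable_mxP F x v).1 dF 0 k).
have dGk k : derivable (fun z => G z 0 k) x v.
  exact: ((derivable_mxP G x v).1 dG 0 k).
rewrite derive_sum => [|k]; last exact: derivableM.
rewrite !edotE -big_split; apply: eq_bigr => k _ /=.
have := deriveM (dFk k) (dGk k).
rewrite (derive_entry 0 k dF) (derive_entry 0 k dG) => /= ->.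
by rewrite addrC; congr (_ + _); exact: mulrC.
Qed.

Lemma Ck_edot k F G : Ck k U F -> Ck k U G ->
  Ck k U (fun z => edot (F z) (G z)).
Proof.
elim: k F G => [F G cF cG x Ux|k IH F G CF CG].
  have -> : (fun z => edot (F z) (G z)) = (fun z => \sum_k F z 0 k * G z 0 k).
    by apply/funext => z; rewrite edotE.
  apply: continuous_sum => k.
  by apply: continuousM; apply: continuous_entry; [exact: cF|exact: cG].
have [[dF cF] [dG cG]] := (CF, CG).
split=> [x Ux|v].
  by apply: differentiable_edot; [exact: dF|exact: dG].
(* Each term of the Leibniz rule keeps one factor undifferentiated; [Ck_weak] lowers its class to
   fit the induction hypothesis. *)
apply: Ck_congr (CkD (IH _ _ (cF v) (Ck_weak CG)) (IH _ _ (Ck_weak CF) (cG v))).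
by move=> x Ux; rewrite derive_edot//; apply: diff_derivable;
  [exact: dF|exact: dG].
Qed.
End CkAlgebra.

(** * The position vector of an immersion *)

Lemma mul_frame_tr (R : realType) n N (f : 'rV[R]_n -> 'rV[R]_N) x y l :
  (y *m (frame f x)^T) 0 l = edot y (partial l f x).
Proof. by rewrite mxE edotE; apply: eq_bigr => k _; rewrite !mxE. Qed.

(** The cancellation in the Koszul formula. Writing F_i and F_ij for first and second partials, [A],
    [B], [C] are the products of F_ij with F_l, F_j with F_il, and F_i with F_jl. *)
Lemma christoffel_arith (R : realFieldType) (d1 d2 d3 a A B C : R) :
  d1 = A + B -> d2 = A + C -> d3 = B + C ->
  2^-1 * (a * (d1 + d2 - d3)) = a * A.
Proof. by move=> -> -> ->; field. Qed.

Section Immersion.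
Variables (R : realType) (n N : nat) (M : riemannianManifold R n).
Variable X : M -> 'rV[R]_N.
Hypothesis X_isometric : isometric_immersion X.
Variable c : chart R n M.
Hypothesis ac : atlas c.
Local Notation F := (X \o param c).
Local Notation U := (cimage c).
Local Notation oU := (@cimage_open _ _ _ c).

Lemma immersion_Ck k : Ck k U F.
Proof. exact: (X_isometric ac).1. Qed.

Lemma derivable_immersion x v : U x -> derivable F x v.
Proof. by move=> Ux; apply/diff_derivable/(immersion_Ck 1).1. Qed.

Lemma derivable_partial_immersion x j v : U x -> derivable (partial j F) x v.
Proof. by move=> Ux; apply/diff_derivable; apply: ((immersion_Ck 2).2 _).1. Qed.

Lemma partial_metric x i j l : U x ->
  partial i (fun y => metric c y j l) x =
  edot (partial i (partial j F) x) (partial l F x) +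
  edot (partial j F x) (partial i (partial l F) x).
Proof.
move=> Ux.
have dp k : derivable (partial k F) x (delta_mx 0 i).
  exact: derivable_partial_immersion.
apply: etrans (derive_edot (dp j) (dp l)).
apply: near_eq_derive; apply: (near_open oU) Ux => y Uy.
exact: (X_isometric ac).2.
Qed.

Lemma partial_comm x i j : U x ->
  partial i (partial j F) x = partial j (partial i F) x.
Proof. exact: (derive_comm_Ck oU _ _ (immersion_Ck 2)). Qed.

Lemma christoffelE x k i j : U x -> christoffel c k i j x =
  \sum_l invmx (metric c x) k l *
    edot (partial i (partial j F) x) (partial l F x).
Proof.
move=> Ux; rewrite /christoffel mulr_sumr; apply: eq_bigr => l _.
pose P a := partial a F x; pose H a b := partial a (partial b F) x.
have Hs a b : H a b = H b a by exact: partial_comm.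
have dm a b d : partial a (fun y => metric c y b d) x =
    edot (H a b) (P d) + edot (P b) (H a d) by exact: partial_metric.
have d2 : partial j (fun y => metric c y i l) x =
    edot (H i j) (P l) + edot (P i) (H j l) by rewrite dm Hs.
have d3 : partial l (fun y => metric c y i j) x =
    edot (P j) (H i l) + edot (P i) (H j l).
  by rewrite (dm l i j) (edotC (H l i)) (Hs l i) (Hs l j).
exact: christoffel_arith (dm i j l) d2 d3.
Qed.

Lemma metricE x i j : U x ->
  metric c x i j = edot (partial i F x) (partial j F x).
Proof. by move=> Ux; exact: (X_isometric ac).2. Qed.

(** The tangential projection of a vector [y] is [y *m J^T *m invmx g *m J], with [g] the metric; by
    [christoffelE] its coefficients in the frame are the Christoffel symbols when [y] is a second
    partial of [X]. *)
Lemma gauss_formula x i j : U x -> sff X c i j x =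
  partial i (partial j F) x - \sum_k christoffel c k i j x *: partial k F x.
Proof.
move=> Ux; rewrite /sff /normal_part.
have := fun l => mul_frame_tr F x (partial i (partial j F) x) l.
have := fun k => christoffelE k i j Ux.
move: (partial i (partial j F) x) => y.
set G := fun k => christoffel c k i j x => GE yE.
set J := frame F x; set t := \sum_k _.
have tE : t = (y *m J^T *m invmx (metric c x)) *m J.
  apply/rowP => b; rewrite summxE mxE; apply: eq_bigr => k _.
  rewrite [LHS]mxE [J k b]mxE; congr (_ * _); rewrite [LHS]GE [RHS]mxE.
  apply: eq_bigr => l _; rewrite yE mulrC; congr (_ * _).
  have gT : (metric c x)^T = metric c x := Defs.metric_sym ac Ux.
  by rewrite -{1}gT -trmx_inv mxE.
have -> : orth_part J y = orth_part J (y - t).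
  by rewrite orth_partB (@orth_part_tangent _ _ _ _ t) ?subr0// tE submxMl.
apply: orth_part_id; rewrite mulmxBl tE.
rewrite -!mulmxA -(metric_gram X_isometric ac Ux).
by rewrite mulVmx ?metric_unitmx// mulmx1 subrr.
Qed.

Lemma partial_sqr_norm s x k : U x ->
  partial k (fun y => s *: edot (F y) (F y)) x =
  s *: (2 * edot (partial k F x) (F x)).
Proof.
move=> Ux.
have dF : derivable F x (delta_mx 0 k) by exact: derivable_immersion.
have dFF : derivable (fun y => edot (F y) (F y)) x (delta_mx 0 k).
  apply: diff_derivable; apply: differentiable_edot;
    exact: (immersion_Ck 1).1.
apply: etrans (deriveZ s dFF) _; rewrite (derive_edot dF dF).
by rewrite (edotC (F x)) mulr_natl mulr2n.
Qed.

Lemma partial2_sqr_norm s x i j : U x ->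
  partial i (partial j (fun y => s *: edot (F y) (F y))) x =
  s * (2 * (edot (partial i (partial j F) x) (F x) + metric c x i j)).
Proof.
move=> Ux; pose P := partial j F.
have dF : derivable F x (delta_mx 0 i) by exact: derivable_immersion.
have dP : derivable P x (delta_mx 0 i) by exact: derivable_partial_immersion.
have dFP : derivable (fun y => edot (P y) (F y)) x (delta_mx 0 i).
  apply: diff_derivable; apply: differentiable_edot; last first.
    exact: (immersion_Ck 1).1.
  exact: ((immersion_Ck 2).2 _).1.
have nE : \forall y \near x, (s * 2) *: edot (P y) (F y) =
    partial j (fun y => s *: edot (F y) (F y)) y.
  apply: (near_open oU) Ux => y Uy; rewrite partial_sqr_norm//.
  exact: esym (mulrA _ _ _).
apply: etrans (esym (near_eq_derive _ nE)) _.
apply: etrans (deriveZ (s * 2) dFP) _; rewrite (derive_edot dP dF).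
by rewrite metricE// (edotC (P x)) /GRing.scale /= mulrA.
Qed.

(** The Hessian of the squared norm contributes the metric, whose trace is [n], and second partials
    of [X], which the Christoffel terms reduce to their normal part. The factor [s] covers both
    signs of the squared norm. *)
Lemma laplacian_sqr_norm s x : U x ->
  laplacian c (fun p => s *: edot (X p) (X p)) x =
  s * (2 * (n%:R + edot (mean_curvature X c x) (F x))).
Proof.
move=> Ux.
have tr : \sum_i \sum_j invmx (metric c x) i j * metric c x i j = n%:R.
  rewrite (metric_gram X_isometric ac Ux) mxtrace_invmx_mul//.
  exact: (gram_posdef X_isometric ac Ux).
rewrite -tr /mean_curvature edot_suml -big_split /= mulr_sumr mulr_sumr.
apply: eq_bigr => i _; rewrite edot_suml -big_split /= mulr_sumr mulr_sumr.
apply: eq_bigr => j _; rewrite edotZl gauss_formula// edotBl edot_suml.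
have -> : partial i (partial j
      ((fun p => s *: edot (X p) (X p)) \o param c)) x =
    s * (2 * (edot (partial i (partial j F) x) (F x) + metric c x i j)).
  exact: partial2_sqr_norm.
have -> : \sum_k christoffel c k i j x *
    partial k ((fun p => s *: edot (X p) (X p)) \o param c) x =
    s * (2 * \sum_k edot (christoffel c k i j x *: partial k F x) (F x)).
  rewrite !mulr_sumr; apply: eq_bigr => k _; rewrite edotZl.
  have -> : partial k ((fun p => s *: edot (X p) (X p)) \o param c) x =
    s * (2 * edot (partial k F x) (F x)) by exact: partial_sqr_norm.
  by rewrite mulrCA (mulrCA 2).
ring.
Qed.

Lemma sqr_norm_Ck k s :
  Ck k U ((fun p => s *: edot (X p) (X p)) \o param c).
Proof.
exact: (CkZ oU s (Ck_edot oU (immersion_Ck k) (immersion_Ck k))).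
Qed.
End Immersion.

(** * Consequences of the soliton equation *)

Section Soliton.
Variables (R : realType) (n N : nat) (M : riemannianManifold R n).
Variable X : M -> 'rV[R]_N.
Hypothesis X_isometric : isometric_immersion X.

Lemma laplacian_cst c (k : R) x : laplacian c (fun _ : M => k) x = 0.
Proof.
have p0 i : partial i ((fun _ : M => k) \o param c) = cst 0.
  by apply/funext => y; rewrite /partial derive_cst.
rewrite /laplacian big1// => i _; rewrite big1// => j _.
rewrite p0 [partial i (cst 0) x]derive_cst big1 ?subr0 ?mulr0// => l _.
by rewrite p0 mulr0.
Qed.

Lemma sqr_norm_continuous (s : R) :
  continuous (fun p => s *: edot (X p) (X p)).
Proof.
move=> p; have [c ac cp] := atlas_cover p.
pose f := (fun p => s *: edot (X p) (X p)) \o param c.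
have cf : {for p, continuous (f \o Defs.coord c)}.
  apply: continuous_comp; first exact: Defs.coord_continuous.
  apply: (Ck_continuous (sqr_norm_Ck X_isometric ac 0 s)).
  by exists p.
apply: near_eq_continuous cf.
by apply: (near_open (@dom_open _ _ _ c)) cp => q cq; rewrite /f /= paramK.
Qed.

Lemma mean_curvature_normal c x :
  mean_curvature X c x *m (frame (X \o param c) x)^T = 0.
Proof.
rewrite mulmx_suml big1// => i _; rewrite mulmx_suml big1// => j _.
by rewrite -scalemxAl [X in _ *: X]orth_part_perp scaler0.
Qed.

Variable C : R.
Hypothesis X_soliton : IMCF_soliton X C.

(** At a zero of [X] the right side of the soliton equation vanishes, while the left side is a
    nonzero multiple of [H]. *)
Lemma soliton_neq0 p : X p != 0.
Proof.
have [c ac cp] := atlas_cover p; have [H0 HE] := X_soliton ac cp.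
apply: contraNneq H0 => Xp0; move: HE.
rewrite Xp0 /normal_part /orth_part mul0mx => /eqP.
rewrite scaler0 scaler_eq0 invr_eq0 sqrf_eq0 => /orP[|//].
by rewrite -sqrf_eq0 enorm_sqr edot_eq0.
Qed.

Lemma soliton_edot c p : atlas c -> dom c p ->
  C != 0 /\ edot (mean_curvature X c (Defs.coord c p)) (X p) = - C^-1.
Proof.
move=> ac cp; have [H0 HE] := X_soliton ac cp.
set H := mean_curvature X c (Defs.coord c p) in H0 HE *.
have HJ : H *m (frame (X \o param c) (Defs.coord c p))^T = 0.
  exact: mean_curvature_normal.
have := congr1 (fun z => edot z H) HE.
rewrite !edotZl enorm_sqr mulVf ?edot_eq0// edotC edot_orth_part// => E.
have C0 : C != 0.
  by apply: contra_eq_neq E => ->; rewrite oppr0 mul0r oner_eq0.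
by split=> //; apply: (mulfI C0); rewrite mulrN divff// E mulNr opprK.
Qed.

Lemma laplacian_soliton (s : R) c p : atlas c -> dom c p ->
  laplacian c (fun p => s *: edot (X p) (X p)) (Defs.coord c p) =
  s * (2 * (n%:R - C^-1)).
Proof.
move=> ac cp; rewrite laplacian_sqr_norm//; last by exists p.
by rewrite /= paramK// (soliton_edot ac cp).2.
Qed.

Lemma soliton_minimal (k : R) c x : atlas c ->
  (forall p, edot (X p) (X p) = k) -> cimage c x ->
  sphere_mean_curvature X c x = 0.
Proof.
move=> ac Xk Ux; have [cp xE] := cimage_param Ux.
set p := param c x in cp xE; set J := frame (X \o param c) x.
(* Differentiating the constant squared norm shows that the position vector is normal. *)
have XJ : X p *m J^T = 0.
  apply/rowP => l; rewrite [RHS]mxE mul_frame_tr edotC.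
  have := partial_sqr_norm X_isometric ac 1 l Ux.
  have -> : (fun y => 1 *: edot ((X \o param c) y) ((X \o param c) y)) = cst k.
    by apply/funext => y /=; rewrite scale1r Xk.
  rewrite [LHS]derive_cst scale1r => /esym/eqP.
  by rewrite mulf_eq0 pnatr_eq0 => /eqP.
have k0 : k != 0 by rewrite -(Xk p) edot_eq0 soliton_neq0.
set H := mean_curvature X c x.
have HX : edot H (X p) = \sum_i \sum_j invmx (metric c x) i j *
    edot (partial i (partial j (X \o param c)) x) (X p).
  rewrite edot_suml; apply: eq_bigr => i _.
  rewrite edot_suml; apply: eq_bigr => j _.
  by rewrite edotZl edotC edot_orth_part// edotC.
(* Projecting to the sphere removes a multiple of [X p], which the normal projection fixes; after
   tracing, [H] has lost exactly its component along [X p]. *)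
have -> : sphere_mean_curvature X c x = H - (edot H (X p) / k) *: X p.
  rewrite HX /H mulr_suml scaler_suml -sumrB; apply: eq_bigr => i _.
  rewrite mulr_suml scaler_suml -sumrB; apply: eq_bigr => j _.
  rewrite /sphere_sff /normal_part orth_part_row ?soliton_neq0//.
  rewrite orth_partB orth_partZ (orth_part_id XJ) Xk.
  by rewrite scalerBr scalerA mulrA.
have [H0 HE] := X_soliton ac cp.
rewrite xE /normal_part (orth_part_id XJ) -/H in HE H0.
have H2 : enorm H ^+ 2 != 0 by rewrite enorm_sqr edot_eq0.
have -> : H = (- (enorm H ^+ 2 * C)) *: X p.
  by rewrite -mulrN -scalerA -HE scalerA divff// scale1r.
by rewrite edotZl Xk mulfK// subrr.
Qed.
End Soliton.

Theorem theorem6p4 (R : realType) (n m : nat) (hn : (1 <= n)%N)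
  (hm : (1 <= m)%N) (Sigma : riemannianManifold R n)
  (X : Sigma -> 'rV[R]_(n + m)) (C : R)
  (X_isometric : isometric_immersion X)
  (Sigma_complete : complete_manifold Sigma)
  (Sigma_noncompact : ~ compact [set: Sigma])
  (X_soliton : IMCF_soliton X C)
  (Sigma_parabolic : parabolic Sigma) :
  ~ (exists r : R, range X `<=` eball r)
  \/
  ((exists r : R, range X `<=` eball r) /\
   forall r : R, 0 < r -> range X `<=` eball r ->
     C = n%:R^-1 /\
     exists r0 : R, [/\ 0 < r0, r0 <= r, range X `<=` esphere r0 &
       minimal_immersion_in_sphere X r0]).
Proof.
have [bX|] := pselect (exists r : R, range X `<=` eball r); last by left.
right; split=> // r r0 Xr.
(* The empty space is compact, so non-compactness provides a point. *)
have [p0] : exists p : Sigma, True.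
  apply: contra_notP Sigma_noncompact => noP.
  have -> : [set: Sigma] = set0.
    by apply/seteqP; split=> // p _; apply: noP; exists p.
  exact: compact0.
move=> _.
have Xr2 p : edot (X p) (X p) <= r ^+ 2.
  have Xpr : enorm (X p) <= r by apply: Xr; exists p.
  by rewrite -enorm_sqr lerXn2r// nnegrE ?sqrtr_ge0// ltW.
(* [s] is 1 or -1 according to the sign of [n%:R - C^-1]. The same bound [r ^+ 2] serves in both
   cases, since the negative of the squared norm is at most 0. *)
have [s s0 [sd sr]] : exists2 s : R, s != 0 &
    0 <= s * (2 * (n%:R - C^-1)) /\ forall p, s * edot (X p) (X p) <= r ^+ 2.
  have [d0|d0] := leP 0 (n%:R - C^-1).
    exists 1; first exact: oner_neq0.
    by split=> [|p]; rewrite mul1r// mulr_ge0.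
  exists (-1); first by rewrite oppr_eq0 oner_eq0.
  split=> [|p]; rewrite mulN1r; first by rewrite oppr_ge0 pmulr_rle0// ltW.
  by apply: (@le_trans _ _ 0); [rewrite oppr_le0 edot_ge0|exact: sqr_ge0].
pose u p := s *: edot (X p) (X p).
have su : subharmonic u.
  (* The hypothesis [1 <= n] supplies the coordinate along which the barrier grows. *)
  apply: (subharmonic_laplacian_ge0 X_isometric (Ordinal hn)).
  - exact: sqr_norm_continuous.
  - by move=> c ac; exact: (sqr_norm_Ck X_isometric ac 2 s).
  - by move=> c ac p cp; rewrite (laplacian_soliton X_isometric X_soliton).
have [k uk] := Sigma_parabolic u su (ex_intro _ _ sr).
have [c ac cp] := atlas_cover p0.
(* Since [u] is constant its Laplacian vanishes, which forces [n%:R = C^-1]. *)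
have := laplacian_soliton X_isometric X_soliton s ac cp.
rewrite -/u (funext uk) laplacian_cst => /esym/eqP.
rewrite mulf_eq0 (negPf s0) mulf_eq0 pnatr_eq0 /= subr_eq0 => /eqP nC.
have Xk p : edot (X p) (X p) = edot (X p0) (X p0).
  by apply: (mulfI s0); exact: etrans (uk p) (esym (uk p0)).
have Xs : range X `<=` esphere (enorm (X p0)).
  by move=> _ [p _ <-]; rewrite /esphere /= /enorm Xk.
split; first by rewrite nC invrK.
exists (enorm (X p0)); split=> //.
- rewrite sqrtr_gt0 lt_neqAle edot_ge0 andbT eq_sym edot_eq0.
  exact: soliton_neq0 X_soliton _.
- by apply: Xr; exists p0.
- split=> // c' ac' x Ux.
  exact: (soliton_minimal X_isometric X_soliton ac' Xk Ux).
Qed.
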